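(* There is a function $\varepsilon(m)\to 0$ as $m\to\infty$ such that every finite graph $G$ with $\chi_f(G)=m$ has a subgraph $H$ (not necessarily induced) with $Z_f(H)\ge\left(\frac14-\varepsilon(m)\right)\frac{m}{\log_2 m}$. Furthermore, this is tight up to a constant factor: there is a constant $C$ such that every subgraph $H$ of the complete graph $K_m$ satisfies $Z_f(H)\le C\frac{m}{\log_2 m}$ for all $m\ge 2$.
   Context: A fractional coloring of $G$ is an assignment of nonnegative real weights to the independent sets of $G$ such that for every vertex $v$ the total weight of the independent sets containing $v$ is at least $1$; $\chi_f(G)$ is the minimum total weight of a fractional coloring. A fractional cocoloring is defined the same way but weights are assigned to cliques and independent sets, each vertex being covered by total weight at least $1$; $Z_f(G)$ is the minimum total weight of a fractional cocoloring. *)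

(* Defs.v *)
From HB Require Import structures.
From mathcomp Require Import all_boot all_order all_algebra.
From mathcomp Require Import all_classical all_reals all_analysis.

Set Implicit Arguments.
Unset Strict Implicit.
Unset Printing Implicit Defensive.

Import Order.TTheory GRing.Theory Num.Theory.
Import numFieldNormedType.Exports.

Local Open Scope ring_scope.
Local Open Scope classical_set_scope.

(* A finite simple graph whose vertex set is a subset of an ambient finite
   type, so that a subgraph of [G : graph T] (possibly on fewer vertices) is
   again a [graph T]. *)
Record graph (T : finType) := Graph {
  verts : {set T};
  edge : rel T;
  edge_sym : symmetric edge;
  edge_irr : irreflexive edge;
  edge_verts : forall u v, edge u v -> (u \in verts) && (v \in verts)
}.

Definition subgraph (T : finType) (H G : graph T) : Prop :=
  verts H \subset verts G /\ subrel (edge H) (edge G).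

Section CompleteGraph.
Variable n : nat.

Let neq_sym : symmetric (fun u v : 'I_n => u != v).
Proof. by move=> u v; rewrite eq_sym. Qed.

Let neq_irr : irreflexive (fun u v : 'I_n => u != v).
Proof. by move=> u; rewrite eqxx. Qed.

Let neq_verts (u v : 'I_n) :
  u != v -> (u \in [set: 'I_n]%SET) && (v \in [set: 'I_n]%SET).
Proof. by rewrite !inE. Qed.

Definition complete_graph : graph 'I_n := Graph neq_sym neq_irr neq_verts.
End CompleteGraph.

Section Fractional.
Variables (R : realType) (T : finType) (G : graph T).

Definition independent (S : {set T}) : bool :=
  (S \subset verts G) && [forall u in S, forall v in S, ~~ edge G u v].

Definition clique (S : {set T}) : bool :=
  (S \subset verts G) &&
  [forall u in S, forall v in S, (u != v) ==> edge G u v].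

(* Only the values of [w] on the sets satisfying [P] matter. *)
Definition fractional_cover (P : pred {set T}) (w : {set T} -> R) : Prop :=
  (forall S, P S -> 0 <= w S) /\
  (forall v, v \in verts G -> 1 <= \sum_(S | P S && (v \in S)) w S).

Definition total_weight (P : pred {set T}) (w : {set T} -> R) : R :=
  \sum_(S | P S) w S.

(* The value of a feasible linear program bounded below by 0 (singletons
   cover [verts G]), so this infimum is a minimum. *)
Definition min_cover (P : pred {set T}) : R :=
  inf [set total_weight P w | w in [set w | fractional_cover P w]].

Definition chi_f : R := min_cover independent.

Definition Z_f : R := min_cover (fun S => clique S || independent S).

End Fractional.

Definition log2 (R : realType) (x : R) : R := ln x / ln 2.

(* Main.v *)
(* Lower bound.  By LP duality there is a vertex weighting [y] of total almost
   [m] in which every independent set of [G] has weight at most 1, and it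
   suffices to find a subgraph [H] all of whose cliques and independent sets
   have weight at most about [4 log2 m].  Keep each edge at random.  Order the
   vertices by decreasing weight.  A set [S] of weight [s] loses weight at most
   [d = s/2] when [d] greedy independent sets are removed, and each remaining
   vertex has [d] earlier neighbours in [S].  Comparing weighted sums with
   prefix sums, some prefix [P] of [S] has about half of its vertices of this
   kind, hence about [(s/4) |P|] inner edges, and lies among the first [m |P|]
   vertices.  There are only [O(m) ^ p] such [P] of size [p], so when [s/4]
   exceeds [log2 m] by a constant a union bound shows that no [P], hence no
   [S], is a clique or an independent set of [H].
   Upper bound.  Ramsey's theorem lets one greedily cover [H] by homogeneous
   sets of size about [log2 m / 4] until about [sqrt m] vertices are left. *)

Require Import Defs.
From HB Require Import structures.
From mathcomp Require Import all_boot all_order all_algebra.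
From mathcomp Require Import all_classical all_reals all_analysis.
From mathcomp Require Import lra zify ring.

Set Implicit Arguments.
Unset Strict Implicit.
Unset Printing Implicit Defensive.

Import Order.TTheory GRing.Theory Num.Theory.
Import numFieldNormedType.Exports.

Local Open Scope ring_scope.
Local Open Scope classical_set_scope.

(** * Farkas' lemma over an ordered field *)

Definition dot (R : realFieldType) (U : finType) (a x : U -> R) : R :=
  \sum_u a u * x u.

Lemma dotBZl (R : realFieldType) (U : finType) (a b x : U -> R) (t : R) :
  dot (fun u => a u - t * b u) x = dot a x - t * dot b x.
Proof.
rewrite /dot mulr_sumr -sumrB; apply: eq_bigr => u _.
by rewrite mulrBl mulrA.
Qed.

Lemma dotBZr (R : realFieldType) (U : finType) (a x z : U -> R) (t : R) :
  dot a (fun u => x u - t * z u) = dot a x - t * dot a z.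
Proof.
rewrite /dot mulr_sumr -sumrB; apply: eq_bigr => u _.
by rewrite mulrBr mulrCA.
Qed.

Lemma dotZr (R : realFieldType) (U : finType) (a x : U -> R) (t : R) :
  dot a (fun u => t * x u) = t * dot a x.
Proof. by rewrite /dot mulr_sumr; apply: eq_bigr => u _; rewrite mulrCA. Qed.

(* Bartl's induction: if the last constraint is needed, a point [x] violating
   the conclusion without it lets one project everything onto its kernel. *)
Lemma farkas (R : realFieldType) (U : finType) (I : eqType) (s : seq I)
    (a : I -> U -> R) (c : U -> R) :
  uniq s ->
  (forall x, (forall i, i \in s -> dot (a i) x <= 0) -> dot c x <= 0) ->
  exists2 l : I -> R, (forall i, 0 <= l i) &
    forall u, c u = \sum_(i <- s) l i * a i u.
Proof.
elim: s a c => [|j s IHs] a c.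
  move=> _ cP; exists (fun=> 0) => // u; rewrite big_nil.
  have : dot c c <= 0 by apply: cP.
  rewrite /dot => c0; apply/eqP; rewrite -sqrf_eq0 eq_le sqr_ge0 andbT.
  apply: le_trans c0; rewrite (bigD1 u) //= expr2 lerDl.
  by apply: sumr_ge0 => v _; rewrite -expr2 sqr_ge0.
rewrite cons_uniq => /andP[js us] cP.
have [cs|] := pselect
    (forall x, (forall i, i \in s -> dot (a i) x <= 0) -> dot c x <= 0).
  have [l l0 lE] := IHs a c us cs.
  exists (fun i => if i == j then 0 else l i) => [i|u].
    by case: ifP => // _; exact: l0.
  rewrite big_cons eqxx mul0r add0r lE; apply: eq_big_seq => i si.
  by case: eqP => // ij; move: js; rewrite -ij si.
move=> /existsNP[z /not_implyP[zs /negP]]; rewrite -ltNge => cz.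
have az : 0 < dot (a j) z.
  rewrite ltNge; apply/negP => az; move: cz; rewrite ltNge => /negP; apply.
  by apply: cP => i; rewrite inE => /predU1P[->//|]; exact: zs.
(* Since [a j] is 1 at [x], every [w] projects along [x] to [w - (a j w) x], in the kernel of
   [a j]. *)
pose x u := (dot (a j) z)^-1 * z u.
have ax : dot (a j) x = 1 by rewrite dotZr mulVf // gt_eqF.
have cx : 0 <= dot c x by rewrite dotZr mulr_ge0 // ?invr_ge0 ltW.
have xs i : i \in s -> dot (a i) x <= 0.
  by move=> /zs si; rewrite dotZr mulr_ge0_le0 // invr_ge0 ltW.
have [|l l0 lE] := IHs (fun i u => a i u - dot (a i) x * a j u)
                       (fun u => c u - dot c x * a j u) us.
  move=> w ws; rewrite dotBZl mulrC -dotBZr; apply: cP => i.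
  rewrite inE dotBZr => /predU1P[->|si]; first by rewrite ax mulr1 subrr.
  by rewrite mulrC -dotBZl; exact: ws.
(* Undoing the projection leaves this coefficient on [a j]; it is nonnegative by the signs of [c]
   and [a i] at [x]. *)
pose t := dot c x - \sum_(i <- s) l i * dot (a i) x.
have t0 : 0 <= t.
  rewrite subr_ge0; apply: le_trans cx.
  rewrite big_seq; apply: sumr_le0 => i si.
  by rewrite mulr_ge0_le0 //; exact: xs.
exists (fun i => if i == j then t else l i) => [i|u]; first by case: ifP.
rewrite big_cons eqxx.
have -> : \sum_(i <- s) (if i == j then t else l i) * a i u =
          \sum_(i <- s) l i * a i u.
  apply: eq_big_seq => i si.
  by case: eqP => // ij; move: js; rewrite -ij si.
rewrite /t mulrBl [X in _ - X]mulr_suml -addrA [- _ + _]addrC -sumrB.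
have /eqP := lE u; rewrite subr_eq => /eqP ->; rewrite addrC; congr (_ + _).
by apply: eq_bigr => i _; ring.
Qed.

(** * Linear programming duality for fractional covers *)

Section Duality.
Variables (R : realType) (T : finType) (G : graph T) (P : pred {set T}).
Hypothesis PV : forall S, P S -> S \subset verts G.
Hypothesis P1 : forall v, v \in verts G -> P [set v]%SET.

(** The infimum of an empty set is a default value, so lower bounds pass to [min_cover] only once
    some cover exists. *)
Lemma cover_exists : exists w : {set T} -> R, fractional_cover G P w.
Proof.
exists (fun=> 1); split=> // v vG.
rewrite (bigD1 [set v]%SET) /=; last by rewrite P1 // inE eqxx.
by rewrite lerDl sumr_ge0.
Qed.

Lemma min_cover_ge (x : R) :
  (forall w, fractional_cover G P w -> x <= total_weight P w) ->
  x <= min_cover R G P.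
Proof.
move=> xP; apply: lb_le_inf.
  by have [w wP] := cover_exists; exists (total_weight P w); exists w.
by move=> _ [w wP <-]; exact: xP.
Qed.

Lemma min_cover_le (w : {set T} -> R) :
  fractional_cover G P w -> min_cover R G P <= total_weight P w.
Proof.
move=> wP; apply: ge_inf; last by exists w.
by exists 0 => _ [w' [w'0 _] <-]; exact: sumr_ge0.
Qed.

Lemma min_cover_ge0 : 0 <= min_cover R G P.
Proof. by apply: min_cover_ge => w [w0 _]; exact: sumr_ge0. Qed.

(** Double counting of [w S * y v] over [v] in [S]: covering makes the sum at least the total of
    [y], and it is at most [s] times the weight of [w]. *)
Lemma weak_duality (y : T -> R) (s : R) :
  (forall v, 0 <= y v) -> (forall v, v \notin verts G -> y v = 0) ->
  0 < s -> (forall S, P S -> \sum_(v in S) y v <= s) ->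
  (\sum_v y v) / s <= min_cover R G P.
Proof.
move=> y0 yG s0 ys; apply: min_cover_ge => w [w0 w1].
rewrite ler_pdivrMr // /total_weight mulr_suml.
apply: (@le_trans _ _ (\sum_(S | P S) w S * \sum_(v in S) y v)); last first.
  by apply: ler_sum => S PS; rewrite ler_wpM2l ?w0 ?ys.
have -> : \sum_(S | P S) w S * \sum_(v in S) y v =
          \sum_v \sum_(S | P S && (v \in S)) w S * y v.
  under eq_bigr do rewrite mulr_sumr.
  by rewrite (exchange_big_dep predT).
apply: ler_sum => v _; rewrite -mulr_suml.
have [vG|/yG->] := boolP (v \in verts G); last by rewrite mulr0.
by rewrite ler_peMl // w1.
Qed.

(** If no such [y] existed, Farkas' lemma for the homogenized packing problem would yield a cover of
    total weight [M]. *)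
Lemma strong_duality (M : R) : P finset.set0 -> M < min_cover R G P ->
  exists y : T -> R,
    [/\ forall v, 0 <= y v, forall v, v \notin verts G -> y v = 0,
        forall S, P S -> \sum_(v in S) y v <= 1 & M < \sum_v y v].
Proof.
move=> P0; rewrite ltNge => /negP Mmin; apply: contrapT => noy; apply: Mmin.
(* [Some v] carries the weight of [v], and [None] a common scale. Row [inl v] makes the weight
   nonnegative; row [inr D] bounds the weight of [D] by the scale. *)
pose a (i : T + {set T}) (o : option T) : R :=
  match i, o with
  | inl v, Some u => - (u == v)%:R
  | inl _, None => 0
  | inr D, Some u => (P D && (u \in D))%:R
  | inr D, None => - (P D)%:R
  end.
pose c (o : option T) : R := if o is Some u then (u \in verts G)%:R else - M.
have optE (f : option T -> R) : \sum_o f o = f None + \sum_v f (Some v).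
  rewrite (bigD1 None) //=; congr (_ + _).
  rewrite (reindex_omap Some id) /=; last by case.
  by apply: eq_bigl => v; rewrite eqxx.
have aT v x : dot (a (inl v)) x = - x (Some v).
  rewrite /dot optE /= mul0r add0r (bigD1 v) //= eqxx mulN1r big1 ?addr0 //.
  by move=> u /negPf ->; rewrite oppr0 mul0r.
have aS S x : P S -> dot (a (inr S)) x = \sum_(v in S) x (Some v) - x None.
  move=> PS; rewrite /dot optE /= PS mulN1r addrC; congr (_ - _).
  rewrite [RHS]big_mkcond; apply: eq_bigr => v _.
  by case: ifP => _; rewrite ?mul1r ?mul0r.
have cE x : dot c x = \sum_(v in verts G) x (Some v) - M * x None.
  rewrite /dot optE /= mulNr addrC; congr (_ - _).
  rewrite [RHS]big_mkcond; apply: eq_bigr => v _.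
  by case: ifP => _; rewrite ?mul1r ?mul0r.
have [x xP|l l0 lE] := @farkas _ _ _ (index_enum (T + {set T})%type) a c
                         (index_enum_uniq _).
  rewrite cE.
  have x0 v : 0 <= x (Some v).
    by have := xP (inl v) (mem_index_enum _); rewrite aT oppr_le0.
  have xS S : P S -> \sum_(v in S) x (Some v) <= x None.
    by move=> PS; have := xP (inr S) (mem_index_enum _); rewrite aS // subr_le0.
  (* The empty set makes the scale nonnegative. At scale 0 the singletons rule out positive weights;
     otherwise dividing by the scale would give an excluded [y]. *)
  have := xS _ P0; rewrite big_set0 le_eqVlt => /predU1P[xN|xN].
    rewrite -xN mulr0 subr0 sumr_le0 // => v vG.
    by have := xS _ (P1 vG); rewrite big_set1 -xN.
  rewrite subr_le0 -ler_pdivrMr // leNgt; apply/negP => My; apply: noy.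
  exists (fun v => if v \in verts G then x (Some v) / x None else 0); split.
  - by move=> v; case: ifP => // _; rewrite divr_ge0 // ltW.
  - by move=> v /negPf ->.
  - move=> S PS; rewrite (eq_bigr (fun v => x (Some v) / x None)).
      by rewrite -mulr_suml ler_pdivrMr // mul1r xS.
    by move=> v vS; rewrite (fintype.subsetP (PV PS)).
  - by rewrite -big_mkcond -mulr_suml.
have sumE (f : T + {set T} -> R) :
    \sum_i f i = \sum_v f (inl v) + \sum_S f (inr S).
  by rewrite big_sumType.
(* The multipliers of the sets form the cover: coordinate [None] gives its total weight, coordinate
   [Some v] the covering of [v]. *)
have -> : M = total_weight P (fun S => l (inr S)).
  have := lE None; rewrite sumE /= big1 ?add0r => [|v _]; last by rewrite mulr0.
  rewrite (eq_bigr (fun S => - (if P S then l (inr S) else 0))); last first.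
    by move=> S _; case: ifP => _; rewrite ?mulrN1 ?oppr0 ?mulr0.
  by rewrite sumrN => /oppr_inj ->; rewrite -big_mkcond.
apply: min_cover_le; split=> [S _|v vG]; first exact: l0.
have := lE (Some v); rewrite sumE /= vG -[leLHS]/(true%:R) => ->.
rewrite [leRHS](_ : _ = \sum_S l (inr S) * (P S && (v \in S))%:R); last first.
  rewrite big_mkcond; apply: eq_bigr => S _.
  by case: ifP => _; rewrite ?mulr1 ?mulr0.
by rewrite gerDr sumr_le0 // => u _; rewrite mulrN oppr_le0 mulr_ge0.
Qed.

End Duality.

(** * Greedy peeling and heavy prefixes of a ranked graph *)

Definition back (T : finType) (G : graph T) (r : T -> nat) (S : {set T}) (v : T)
    : {set T} :=
  [set u in S | (r u < r v)%N && edge G u v]%SET.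

(** Each edge occurs once, oriented by increasing rank, so it reads a single random bit. *)
Definition inner_edges (T : finType) (G : graph T) (r : T -> nat) (P : {set T})
    : {set T * T} :=
  [set p | [&& p.1 \in P, p.2 \in P, (r p.1 < r p.2)%N & edge G p.1 p.2]]%SET.

Section Certificate.
Variables (R : realType) (T : finType) (G : graph T) (r : T -> nat).
Hypothesis r_inj : injective r.

Lemma card_inner_edges (P : {set T}) :
  #|inner_edges G r P| = (\sum_(v in P) #|back G r P v|)%N.
Proof.
under [RHS]eq_bigr do rewrite -sum1_card.
rewrite pair_big_dep /= -sum1_card.
rewrite (reindex_inj (inv_inj (@swap_pairK T T))) /=.
by apply: eq_bigl => -[u v]; rewrite !inE /=; case: (_ \in P); rewrite ?andbF.
Qed.

(** Scan [S] by increasing rank, taking a vertex unless a chosen one is adjacent to it; a rejected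
    vertex thus has an earlier neighbour in [I]. *)
Lemma greedy_independent (S : {set T}) : S \subset verts G ->
  exists I : {set T}, [/\ I \subset S, independent G I &
    forall v, v \in S -> v \notin I ->
      exists u, [&& u \in I, (r u < r v)%N & edge G u v]].
Proof.
move=> SG.
have [j [I [IS Ii Ij Idom]]] : exists j, exists I : {set T},
    [/\ I \subset S, independent G I, forall v, v \in S -> (r v < j)%N &
    forall v, v \in S -> (r v < j)%N -> v \notin I ->
      exists u, [&& u \in I, (r u < r v)%N & edge G u v]].
  have [j jS] : exists j, forall v, v \in S -> (r v < j)%N.
    by exists (\max_v r v).+1 => v _; rewrite ltnS leq_bigmax.
  suff [I [IS Ii _ Idom]] : exists I : {set T},
    [/\ I \subset S, independent G I, forall v, v \in I -> (r v < j)%N &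
    forall v, v \in S -> (r v < j)%N -> v \notin I ->
      exists u, [&& u \in I, (r u < r v)%N & edge G u v]].
    by exists j, I.
  elim: {jS}j => [|j [I [IS Ii Ij Idom]]].
    exists finset.set0; split=> //; rewrite ?finset.sub0set //.
      apply/andP; split; first exact: finset.sub0set.
      by apply/forall_inP => u; rewrite inE.
    by move=> v; rewrite inE.
  have [v /andP[vS /eqP vj]|noj] := pickP [pred v in S | r v == j]; last first.
    exists I; split=> // [v vI|v vS]; first by rewrite ltnS ltnW // Ij.
    rewrite ltnS leq_eqVlt => /predU1P[vj|]; last exact: Idom.
    by have := noj v; rewrite /= vS vj eqxx.
  have vlt u : (r u < j.+1)%N -> (u = v) \/ (r u < j)%N.
    by rewrite ltnS leq_eqVlt -vj => /predU1P[/r_inj|]; [left | right].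
  have [/existsP[u /andP[uI uv]]|/existsPn nov] :=
      boolP [exists u, (u \in I) && edge G u v].
    exists I; split=> // [w wI|w wS /vlt[->|wj]]; first by rewrite ltnS ltnW // Ij.
      by exists u; rewrite uI vj Ij.
    exact: Idom.
  have vI u : u \in I -> ~~ edge G u v by have := nov u; case: (u \in I).
  exists (v |: I)%SET; split.
  - by rewrite finset.subUset finset.sub1set vS.
  - have /andP[IG /forall_inP Iind] := Ii.
    apply/andP; split.
      by rewrite finset.subUset finset.sub1set (fintype.subsetP SG).
    apply/forall_inP => x /setU1P[->|xI]; apply/forall_inP => z /setU1P[->|zI].
    + by rewrite edge_irr.
    + by rewrite edge_sym vI.
    + exact: vI.
    + by have /forall_inP := Iind _ xI; apply.
  - by move=> u /setU1P[->|/Ij]; rewrite ?vj // ltnS => /ltnW.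
  - move=> w wS /vlt[->|wj]; rewrite !inE negb_or ?eqxx //= => /andP[_ wI].
    have [u /and3P[uI uw e]] := Idom w wS wj wI.
    by exists u; rewrite !inE uI uw e orbT.
exists I; split=> // v vS; apply: Idom => //; exact: Ij.
Qed.

Variable y : T -> R.
Hypothesis y_ge0 : forall v, 0 <= y v.
Hypothesis y_ind : forall I, independent G I -> \sum_(v in I) y v <= 1.

(* Removing [d] greedy independent sets leaves only vertices having an earlier
   neighbour in each of them. *)
Lemma peel (d : nat) (S : {set T}) : S \subset verts G ->
  exists B : {set T}, [/\ B \subset S,
    \sum_(v in S) y v <= d%:R + \sum_(v in B) y v &
    forall v, v \in B -> (d <= #|back G r S v|)%N].
Proof.
elim: d S => [|d IHd] S SG.
  by exists S; split=> //; rewrite add0r.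
have [I [IS Ii Idom]] := greedy_independent SG.
have [|B [BS yB dB]] := IHd (S :\: I)%SET.
  exact: fintype.subset_trans (finset.subsetDl _ _) SG.
exists B; split.
- exact: fintype.subset_trans BS (finset.subsetDl _ _).
- rewrite (big_setID I) /= (finset.setIidPr IS) -natr1.
  by have := y_ind Ii; lra.
- move=> v vB; have := fintype.subsetP BS v vB; rewrite inE => /andP[vI vS].
  have [u /and3P[uI uv e]] := Idom v vS vI.
  apply: (@leq_trans (#|u |: back G r (S :\: I) v|)%SET).
    by rewrite finset.cardsU1 !inE uI /= add1n ltnS dB.
  apply: subset_leq_card; apply/fintype.subsetP => w.
  rewrite !inE => /orP[/eqP->|/andP[/andP[_ ->]]//].
  by rewrite uv e (fintype.subsetP IS).
Qed.

Hypothesis y_anti : forall u v, (r u < r v)%N -> y v <= y u.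

(** Abel summation: [y] is nonnegative and nonincreasing in the rank, so the weighted sum is a
    nonnegative combination of prefix sums of [f]. *)
Lemma prefix_sum_gt0 (f : T -> R) : 0 < \sum_v y v * f v ->
  exists j, 0 < \sum_(v | (r v < j)%N) f v.
Proof.
move=> yf; apply: contrapT => nof; move: yf; apply/negP; rewrite -leNgt.
have f0 j : \sum_(v | (r v < j)%N) f v <= 0.
  by rewrite leNgt; apply/negP => fj; apply: nof; exists j.
(* The shift [t] serves the induction: replacing it by the last weight [y v] kills the last term at
   the cost of a multiple of a prefix sum. *)
have H j t : 0 <= t -> (forall v, (r v < j)%N -> t <= y v) ->
    \sum_(v | (r v < j)%N) (y v - t) * f v <= 0.
  elim: j t => [|j IHj] t t0 ty; first by rewrite big_pred0.
  have [v /eqP vj|noj] := pickP [pred v | r v == j]; last first.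
    rewrite (eq_bigl (fun v => (r v < j)%N)) => [|v].
      by apply: IHj => // v vj; apply: ty; rewrite ltnS ltnW.
    by rewrite ltnS leq_eqVlt [r v == j]noj.
  have -> : \sum_(u | (r u < j.+1)%N) (y u - t) * f u =
      \sum_(u | (r u < j.+1)%N) (y u - y v) * f u +
      (y v - t) * \sum_(u | (r u < j.+1)%N) f u.
    by rewrite mulr_sumr -big_split /=; apply: eq_bigr => u _; ring.
  rewrite -[leRHS]addr0 lerD // ?mulr_ge0_le0 // ?subr_ge0 ?ty ?vj //.
  rewrite (bigD1 v) /= ?vj // subrr mul0r add0r.
  rewrite (eq_bigl (fun v => (r v < j)%N)) => [|u].
    by apply: IHj => // u uj; apply: y_anti; rewrite vj.
  rewrite ltnS ltn_neqAle andbC -vj; congr (_ && _).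
  by rewrite (inj_eq r_inj).
have := H (\max_v r v).+1 0 (lexx 0) (fun v _ => y_ge0 v).
rewrite [X in X <= _](eq_bigl predT) => [|v]; last by rewrite ltnS leq_bigmax.
by under eq_bigr do rewrite subr0.
Qed.

Hypothesis r_dense : forall v, (r v <= #|[set u | (r u < r v)%N]%SET|)%N.

(* [f] below has positive weighted sum, and positivity of one of its prefix sums
   gives both that most of [P] lies in [B] and that the prefix is not too long. *)
Lemma heavy_prefix (k n : nat) (S : {set T}) : S \subset verts G ->
  (0 < n)%N -> \sum_v y v <= n%:R -> (4 * k + 2)%:R < \sum_(v in S) y v ->
  exists P : {set T}, [/\ P \subset S, P != finset.set0,
    forall v, v \in P -> (r v < n * #|P|)%N &
    (k * #|P| <= #|inner_edges G r P|)%N].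
Proof.
move=> SG n0 yn yS; have [B [BS yB kB]] := peel (2 * k) SG.
(* Peeling costs [2 * k], so B outweighs half of S by at least half the weight of S minus [2 * k],
   which exceeds 1; the last term of [f] costs at most 1. *)
pose f v : R := (v \in B)%:R - (v \in S)%:R / 2 - n%:R^-1.
have yE (D : {set T}) : \sum_v y v * (v \in D)%:R = \sum_(v in D) y v.
  rewrite [RHS]big_mkcond; apply: eq_bigr => v _.
  by case: ifP; rewrite ?mulr1 ?mulr0.
have [|j fj] := @prefix_sum_gt0 f.
  have -> : \sum_v y v * f v =
      \sum_(v in B) y v - (\sum_(v in S) y v) / 2 - (\sum_v y v) / n%:R.
    rewrite -!yE !mulr_suml -!sumrB; apply: eq_bigr => v _.
    by rewrite !mulrBr mulrA.
  have : (\sum_v y v) / n%:R <= 1 by rewrite ler_pdivrMr ?ltr0n // mul1r.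
  by move: yS yB; rewrite natrD !natrM; lra.
pose V := [set v | (r v < j)%N]%SET.
have cE (D : {set T}) : \sum_(v | (r v < j)%N) (v \in D)%:R = #|V :&: D|%:R :> R.
  rewrite -sum1_card natr_sum [RHS]big_mkcond /= [LHS]big_mkcond /=.
  by apply: eq_bigr => v _; rewrite !inE; case: (r v < j)%N; case: (v \in D).
have {fj} : 0 < #|V :&: B|%:R - #|V :&: S|%:R / 2 - #|V|%:R / n%:R :> R.
  have cV : \sum_(v | (r v < j)%N) n%:R^-1 = #|V|%:R / n%:R :> R.
    rewrite -(finset.setIT V) -cE mulr_suml.
    by apply: eq_bigr => v _; rewrite finset.in_setT mul1r.
  by move: fj; rewrite /f !sumrB -mulr_suml !cE cV.
set P := (V :&: S)%SET; set b := #|(V :&: B)%SET| => fj.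
have BP : V :&: B \subset P by exact: finset.setIS.
have bP : (b <= #|P|)%N by exact: subset_leq_card.
have Vn0 : 0 <= #|V|%:R / n%:R :> R by rewrite divr_ge0.
(* Dropping one or the other subtracted term of [fj] bounds [P] and the prefix [V] by multiples of
   [b]. *)
have Pb : (#|P| < 2 * b)%N by rewrite -(ltr_nat R) natrM; lra.
have Vb : (#|V| < n * b)%N.
  rewrite -(ltr_nat R) natrM mulrC -ltr_pdivrMr ?ltr0n //.
  by have : 0 <= #|P|%:R :> R by []; lra.
exists P; split.
- exact: finset.subsetIr.
- by rewrite -card_gt0; lia.
- move=> v; rewrite !inE => /andP[vj _].
  apply: leq_ltn_trans (r_dense v) _; apply: leq_trans (leq_trans Vb _).
    rewrite ltnS; apply: subset_leq_card; apply/fintype.subsetP => u.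
    by rewrite !inE => /ltn_trans; apply.
  by rewrite leq_mul2l bP orbT.
- rewrite card_inner_edges; apply: (@leq_trans (2 * k * b)).
    by rewrite [(2 * k)%N]mulnC -mulnA leq_mul2l (ltnW Pb) orbT.
  rewrite mulnC -sum_nat_const.
  apply: (@leq_trans (\sum_(v in V :&: B) #|back G r P v|)).
    (* Earlier neighbours in [S] of a vertex of the prefix lie in the prefix, hence in [P]. *)
    apply: leq_sum => v; rewrite !inE => /andP[vj vB].
    apply: leq_trans (kB v vB) _; apply: subset_leq_card.
    apply/fintype.subsetP => u; rewrite !inE => /and3P[-> uv ->].
    by rewrite uv (ltn_trans uv).
  rewrite [X in (_ <= X)%N](big_setID (V :&: B)) /= (finset.setIidPr BP).
  exact: leq_addr.
Qed.

End Certificate.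

(** * Counting subsets and the union bound *)

Lemma expn_le_ffact (m p : nat) : (m ^ p <= (m + p) ^_ p)%N.
Proof.
elim: p => [|p IHp]; first by rewrite ffactn0.
by rewrite addnS ffactSS expnS leq_mul // ltnW // ltnS leq_addr.
Qed.

Lemma ffact_le_expn (m p : nat) : (m ^_ p <= m ^ p)%N.
Proof.
elim: p m => [|p IHp] [|m] //; rewrite ffactSS expnS leq_mul2l /=.
by apply: leq_trans (IHp m) _; case: p {IHp} => // p; rewrite leq_exp2r.
Qed.

Lemma bin_le_exp2 (m p : nat) : ('C(m, p) <= 2 ^ m)%N.
Proof.
rewrite -{1 2}(card_ord m) -cardsT -card_powerset -cards_draws.
apply: subset_leq_card; apply/fintype.subsetP => A.
by rewrite !inE => /andP[].
Qed.

(** Multiplied by [p!], this reduces to [p ^ p <= 4 ^ p * p!], which follows from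
    [p ^ p <= (2p) ^_ p = 'C(2p, p) * p!]. *)
Lemma bin_mul_le (n p : nat) : ('C(n * p, p) <= (4 * n) ^ p)%N.
Proof.
rewrite -(leq_pmul2r (fact_gt0 p)) bin_ffact.
apply: leq_trans (ffact_le_expn _ _) _.
rewrite !expnMn [X in (X <= _)%N]mulnC [X in (_ <= X)%N]mulnAC leq_mul2r.
apply/orP; right.
apply: leq_trans (expn_le_ffact _ _) _; rewrite -bin_ffact leq_mul2r.
apply/orP; right; apply: leq_trans (bin_le_exp2 _ _) _.
by rewrite addnn -mul2n expnM.
Qed.

Lemma card_subsets_rank (T : finType) (r : T -> nat) (j p : nat) : injective r ->
  (#|[set P : {set T} | (#|P| == p) && [forall v in P, (r v < j)%N]]%SET|
     <= 'C(j, p))%N.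
Proof.
move=> r_inj; pose V := [set v | (r v < j)%N]%SET.
have Vj : (#|V| <= j)%N.
  rewrite -[leqRHS]card_ord; case: j @V => [|j] V.
    by rewrite eq_card0 // => v; rewrite !inE.
  apply: (@leq_card_in _ _ (fun v => inord (r v) : 'I_j.+1)) => u v.
  rewrite !inE => uj vj /(congr1 (@nat_of_ord _)).
  by rewrite !inordK // => /r_inj.
apply: leq_trans (leq_bin2l _ Vj); rewrite -cards_draws; apply: subset_leq_card.
apply/fintype.subsetP => P; rewrite !inE andbC => /andP[/forall_inP Pj ->].
by rewrite andbT; apply/fintype.subsetP => v /Pj; rewrite inE.
Qed.

(** With [c] read as a two-colouring of [X], these are the [c] monochromatic on [E]; complementation
    exchanges the colours. *)
Lemma card_mono_subsets (X : finType) (E : {set X}) :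
  (#|[set c : {set X} | (E \subset c) || (E \subset ~: c)]%SET|
     <= 2 * 2 ^ (#|X| - #|E|))%N.
Proof.
have dis : #|[set c : {set X} | E \subset ~: c]%SET| = (2 ^ (#|X| - #|E|))%N.
  rewrite -[E in RHS]finset.setCK -finset.cardsCs -card_powerset.
  apply: eq_card => c.
  by rewrite !inE finset.subsetC.
have sub : #|[set c : {set X} | E \subset c]%SET| = (2 ^ (#|X| - #|E|))%N.
  rewrite -dis -[RHS](card_imset _ (inv_inj (@finset.setCK X))).
  apply: eq_card => c; apply/idP/imsetP => [|[d]].
    by rewrite inE => Ec; exists (~: c)%SET; rewrite ?inE finset.setCK.
  by rewrite !inE => Ed ->.
rewrite mul2n -addnn -{1}sub -dis; apply: leq_trans (leq_card_setU _ _).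
by apply: subset_leq_card; apply/fintype.subsetP => c; rewrite !inE.
Qed.

(* Union bound: a random [c] contains or misses all of [E P] with probability
   [2 * 2 ^- #|E P|], and there are at most [(4 n) ^ p] sets [P] of size [p]. *)
Lemma exists_splitting (T X : finType) (r : T -> nat) (E : {set T} -> {set X})
    (k n : nat) : injective r -> (16 * n <= 2 ^ k)%N ->
  exists c : {set X}, forall P : {set T}, P != finset.set0 ->
    (forall v, v \in P -> (r v < n * #|P|)%N) -> (k * #|P| <= #|E P|)%N ->
    ~~ (E P \subset c) && ~~ (E P \subset ~: c)%SET.
Proof.
move=> r_inj nk.
pose F (P : {set T}) := [&& P != finset.set0,
  [forall v in P, (r v < n * #|P|)%N] & (k * #|P| <= #|E P|)%N].
pose bad (c : {set X}) P := (E P \subset c) || (E P \subset ~: c)%SET.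
suff [c cF] : exists c, forall P, F P -> ~~ bad c P.
  exists c => P P0 Pr Pk; rewrite -negb_or; apply: cF.
  by rewrite /F P0 Pk andbT; apply/forall_inP.
apply: contrapT => nogood.
have allbad c : (1 <= \sum_(P | F P) (bad c P : nat))%N.
  have [P FP cP] : exists2 P, F P & bad c P.
    apply: contrapT => noP; apply: nogood; exists c => P FP.
    by apply/negP => cP; apply: noP; exists P.
  by rewrite (bigD1 P) //= cP.
have : (2 ^ #|X| <= \sum_(P | F P) 2 * 2 ^ (#|X| - #|E P|))%N.
  have -> : (2 ^ #|X| = \sum_(c : {set X}) 1)%N.
    by rewrite sum1_card -[RHS]cardsT -finset.powersetT card_powerset cardsT.
  apply: (@leq_trans (\sum_(c : {set X}) \sum_(P | F P) bad c P)).
    by apply: leq_sum => c _; exact: allbad.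
  rewrite exchange_big /=; apply: leq_sum => P _.
  apply: leq_trans (card_mono_subsets (E P)).
  rewrite -sum1_card [X in (_ <= X)%N]big_mkcond /=; apply: leq_sum => c _.
  by rewrite inE -/(bad c P); case: (bad c P).
apply/negP; rewrite -ltnNge.
rewrite -(ltr_nat rat) natrX natr_sum.
have FE P : F P -> (2 * 2 ^ (#|X| - #|E P|))%:R <=
    2 ^+ #|X| * (2 * (2 ^+ k)^-1 ^+ #|P|) :> rat.
  move=> /and3P[_ _ PE]; rewrite natrM natrX mulrCA ler_pM2l //.
  rewrite -exprVn -exprM exprVn ler_pdivlMr ?exprn_gt0 // -exprD.
  rewrite ler_eXn2l // ?ltr1n //; apply: leq_trans (leq_add (leqnn _) PE) _.
  by rewrite subnK // max_card.
apply: le_lt_trans (ler_sum _ FE) _.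
rewrite -mulr_sumr -mulr_sumr gtr_pMr ?exprn_gt0 //.
(* Size [p] contributes at most [2 * (4 * n / 2 ^ k) ^ p <= 2 * 4 ^- p], which over [p >= 1] sums to
   at most 2/3. *)
have half : \sum_(p < #|T|) 4^-1 ^+ p.+1 <= 3^-1 :> rat.
  have -> m : \sum_(p < m) 4^-1 ^+ p.+1 = 3^-1 - 3^-1 * 4^-1 ^+ m :> rat.
    elim: m => [|m IHm]; first by rewrite big_ord0 expr0; lra.
    by rewrite big_ord_recr /= IHm exprS; field.
  by rewrite gerDl oppr_le0 mulr_ge0 // exprn_ge0.
suff : \sum_(P | F P) (2 ^+ k)^-1 ^+ #|P| <= \sum_(p < #|T|) 4^-1 ^+ p.+1 :> rat.
  by move=> /le_trans/(_ half); lra.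
have FT P : F P -> (#|P|.-1 < #|T|)%N.
  move=> /and3P[]; rewrite -card_gt0 => P0 _ _.
  by rewrite prednK // max_card.
case TE: #|T| => [|m].
  by rewrite big_pred0 ?big_ord0 // => P; apply/negP => /FT; rewrite TE.
rewrite (partition_big (fun P : {set T} => inord #|P|.-1 : 'I_m.+1) predT) //=.
apply: ler_sum => p _.
pose Q := [set P : {set T} |
  (#|P| == p.+1) && [forall v in P, (r v < n * p.+1)%N]]%SET.
apply: (@le_trans _ _ (\sum_(P in Q) (2 ^+ k)^-1 ^+ p.+1)).
  rewrite big_mkcond [leRHS]big_mkcond; apply: ler_sum => P _.
  case: ifP => [/andP[FP /eqP Pp]|_]; last first.
    by case: ifP => // _; rewrite exprn_ge0 // invr_ge0 exprn_ge0.
  have cP : #|P| = p.+1.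
    have /and3P[] := FP; rewrite -card_gt0 => P0 _ _.
    by rewrite -Pp inordK ?prednK // -TE max_card.
  by have /and3P[_ Pr _] := FP; rewrite /Q inE -cP eqxx Pr.
rewrite sumr_const -[leLHS]mulr_natl.
apply: (@le_trans _ _ (((4 * n) ^ p.+1)%:R * (2 ^+ k)^-1 ^+ p.+1)).
  rewrite ler_wpM2r // ?exprn_ge0 ?invr_ge0 ?exprn_ge0 // ler_nat.
  by apply: leq_trans (card_subsets_rank _ _ r_inj) (bin_mul_le _ _).
rewrite natrX -exprMn lerXn2r ?nnegrE ?mulr_ge0 ?invr_ge0 ?exprn_ge0 //.
rewrite ler_pdivrMr ?exprn_gt0 //.
by move: nk; rewrite -(ler_nat rat) natrX natrM natrM; lra.
Qed.

(** * Subgraphs without heavy homogeneous sets *)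

(** The rank is the position in a list of the vertices by decreasing weight, so it has no gaps. *)
Lemma exists_ranking (R : realType) (T : finType) (y : T -> R) :
  exists r : T -> nat, [/\ injective r,
    forall u v, (r u < r v)%N -> y v <= y u &
    forall v, (r v <= #|[set u | (r u < r v)%N]%SET|)%N].
Proof.
pose leT u v := y v <= y u; pose s := sort leT (enum T).
have sT v : v \in s by rewrite mem_sort mem_enum.
have us : uniq s by rewrite sort_uniq enum_uniq.
exists (fun v => index v s); split=> [u v|u v uv|v].
- exact: index_inj.
- apply: (@sorted_ltn_index _ leT _ s) => //.
    by move=> b a c ba cb; exact: le_trans cb ba.
  by apply: sort_sorted => a b; exact: le_total.
- have vs : (index v s <= size s)%N by exact: index_size.
  rewrite -{1}(size_takel vs) -(card_uniqP (take_uniq _ us)).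
  by apply: subset_leq_card; apply/fintype.subsetP => u; rewrite inE in_take_leq.
Qed.

(* The random bit of an edge is read at its pair oriented by increasing rank. *)
Section KeepSubgraph.
Variables (T : finType) (G : graph T) (r : T -> nat) (c : {set T * T}).
Hypothesis r_inj : injective r.

Definition keep_edge : rel T := fun u v =>
  edge G u v && (if (r u < r v)%N then (u, v) \in c else (v, u) \in c).

Lemma keep_edge_sym : symmetric keep_edge.
Proof.
move=> u v; rewrite /keep_edge edge_sym; congr (_ && _).
by case: ltngtP => // /r_inj ->.
Qed.

Lemma keep_edge_irr : irreflexive keep_edge.
Proof. by move=> u; rewrite /keep_edge edge_irr. Qed.

Lemma keep_edge_verts u v : keep_edge u v -> (u \in verts G) && (v \in verts G).
Proof. by move=> /andP[/edge_verts]. Qed.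

Definition keep_graph := Graph keep_edge_sym keep_edge_irr keep_edge_verts.

End KeepSubgraph.

(** A heavier homogeneous set would contain a prefix [P] with many inner edges; by the choice of [c]
    some are kept and some deleted, excluding both kinds. *)
Lemma exists_light_subgraph (R : realType) (T : finType) (G : graph T)
    (y : T -> R) (k n : nat) :
  (forall v, 0 <= y v) ->
  (forall I, independent G I -> \sum_(v in I) y v <= 1) ->
  (0 < n)%N -> \sum_v y v <= n%:R -> (16 * n <= 2 ^ k)%N ->
  exists H : graph T, [/\ subgraph H G, verts H = verts G &
    forall S, clique H S || independent H S ->
      \sum_(v in S) y v <= (4 * k + 2)%:R].
Proof.
move=> y0 yI n0 yn nk; have [r [r_inj y_anti r_dense]] := exists_ranking y.
have [c cP] := exists_splitting (inner_edges G r) r_inj nk.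
exists (keep_graph G c r_inj); split=> //.
  by split=> // u v /andP[].
move=> S hS; rewrite leNgt; apply/negP => yS.
have SG : S \subset verts G by case/orP: hS => /andP[].
have [P [PS P0 Pr Pk]] := heavy_prefix r_inj y0 yI y_anti r_dense SG n0 yn yS.
have /andP[/subsetPn[[u v]]] := cP P P0 Pr Pk.
rewrite inE /= => /and4P[uP vP uv e] uvc /subsetPn[[u' v']].
rewrite inE /= => /and4P[uP' vP' uv' e'] uvc'.
have inS := fintype.subsetP PS.
case/orP: hS => /andP[_ /forall_inP hS].
  have /forall_inP/(_ _ (inS _ vP)) := hS _ (inS _ uP).
  have -> : u != v by apply: contraTneq uv => ->; rewrite ltnn.
  by rewrite /= /keep_edge e uv (negbTE uvc).
have /forall_inP/(_ _ (inS _ vP')) := hS _ (inS _ uP').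
by move: uvc'; rewrite inE negbK /= /keep_edge e' uv' => ->.
Qed.

(** * The lower bound through weak duality *)

Lemma independent_set1 (T : finType) (G : graph T) (v : T) :
  v \in verts G -> independent G [set v]%SET.
Proof.
move=> vG; rewrite /independent finset.sub1set vG /=.
apply/forall_inP => u /set1P ->; apply/forall_inP => w /set1P ->.
by rewrite edge_irr.
Qed.

Lemma independent_set0 (T : finType) (G : graph T) : independent G finset.set0.
Proof.
by rewrite /independent finset.sub0set; apply/forall_inP => u; rewrite inE.
Qed.

Lemma independent_sub (T : finType) (G : graph T) (S : {set T}) :
  independent G S -> S \subset verts G.
Proof. by case/andP. Qed.

Lemma homogeneous_set1 (T : finType) (G : graph T) (v : T) :
  v \in verts G -> clique G [set v]%SET || independent G [set v]%SET.
Proof. by move=> /independent_set1 ->; rewrite orbT. Qed.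

Lemma homogeneous_sub (T : finType) (G : graph T) (S : {set T}) :
  clique G S || independent G S -> S \subset verts G.
Proof. by case/orP => /andP[]. Qed.

Lemma exp2_le_log2 (R : realType) (x : R) (i j : nat) : 0 < x ->
  (2 ^ j)%:R <= 2 ^+ i * x -> j%:R <= i%:R + log2 x.
Proof.
move=> x0; rewrite natrX => jx; have ln2 : 0 < ln 2 :> R by rewrite ln_gt0 // ltr1n.
rewrite /log2 -(ler_pM2r ln2) mulrDl divfK ?gt_eqF // !mulr_natl.
rewrite -!lnXn // -lnM ?posrE ?exprn_gt0 // ler_ln ?posrE ?exprn_gt0 //.
by rewrite mulr_gt0 // exprn_gt0.
Qed.

(** The dual weighting of [G] has total above [m - 1], the 1 making room for strictness in strong
    duality; dividing it by the weight bound for homogeneous sets of [H] bounds [Z_f] of [H]. *)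
Lemma exists_subgraph_Z_f (R : realType) (T : finType) (G : graph T) :
  2 < chi_f R G ->
  exists H : graph T, subgraph H G /\
    (chi_f R G - 1) / (4 * log2 (chi_f R G) + 26) <= Z_f R H.
Proof.
set m := chi_f R G => m2.
have [||//||y [y0 yG yI ym]] := @strong_duality R T G (independent G) _ _ (m - 1).
- exact: independent_sub.
- exact: independent_set1.
- exact: independent_set0.
- by rewrite ltrBlDr ltrDl.
have yle : \sum_v y v <= m.
  rewrite -[leLHS]divr1; apply: weak_duality => //; exact: independent_set1.
(* [2 ^ k.-1 <= 16 n <= 32 m], so [4 k + 2 <= 4 (log2 m + 6) + 2]. *)
pose n := (Num.truncn m).+1; pose k := (trunc_log 2 (16 * n)).+1.
have m0 : 0 < m by lra.
have mn : m <= n%:R by rewrite ltW // truncnS_gt.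
have nm : n%:R <= 2 * m.
  have : (Num.truncn m)%:R <= m by rewrite truncn_le ltW.
  by rewrite /n -natr1; lra.
have nk : (16 * n <= 2 ^ k)%N by rewrite ltnW // trunc_log_ltn.
have [H [HG HV HS]] :=
  exists_light_subgraph y0 yI (ltn0Sn _) (le_trans yle mn) nk.
exists H; split=> //.
have ln2 : 0 < ln 2 :> R by rewrite ln_gt0 // ltr1n.
have logm : 0 < log2 m by rewrite /log2 divr_gt0 // ln_gt0; lra.
have k_le : (4 * k + 2)%:R <= 4 * log2 m + 26.
  have k5 : (trunc_log 2 (16 * n))%:R <= 5 + log2 m.
    apply: exp2_le_log2 => //.
    apply: (@le_trans _ _ (16 * n)%:R); first by rewrite ler_nat trunc_logP.
    rewrite natrM (_ : 2 ^+ 5 * m = 16%:R * (2 * m)); last by ring.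
    by rewrite ler_pM2l.
  rewrite natrD natrM /k -[(trunc_log _ _).+1%:R]natr1.
  by move: (trunc_log 2 (16 * n))%:R k5 => x; lra.
have : (\sum_v y v) / (4 * k + 2)%:R <= Z_f R H.
  apply: weak_duality => //; first exact: homogeneous_set1.
  by move=> v; rewrite HV; exact: yG.
apply: le_trans; apply: ler_pM => //; first by lra.
- by rewrite invr_ge0; lra.
- exact: ltW.
- by rewrite lef_pV2 ?posrE ?ltr0n ?addn_gt0 ?orbT //; lra.
Qed.

(** * The upper bound by Ramsey's theorem *)

(** Erdos-Szekeres recursion: the neighbours or the non-neighbours of a vertex [v] have half the
    required size, and [v] extends a clique among the former or an independent set among the
    latter. *)
Lemma ramsey_homogeneous (T : finType) (G : graph T) (a b : nat) (U : {set T}) :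
  U \subset verts G -> (2 ^ (a + b) <= #|U|)%N ->
  exists S : {set T}, S \subset U /\
    (clique G S && (a <= #|S|)%N || independent G S && (b <= #|S|)%N).
Proof.
have [j jab] := ubnP (a + b).
elim: j a b jab U => // j IHj [|a] [|b] jab U UG Uab;
  try by exists finset.set0; split; rewrite ?finset.sub0set // independent_set0
    /clique finset.sub0set ?orbT //=; apply/orP; left; rewrite andbT;
    apply/forall_inP => u; rewrite inE.
have [v vU] : exists v, v \in U.
  by apply/finset.set0Pn; rewrite -card_gt0 (leq_trans _ Uab) // expn_gt0.
have vG := fintype.subsetP UG v vU.
pose N := [set u in U | edge G v u]%SET.
pose M := [set u in U :\ v | ~~ edge G v u]%SET.
have NU : N \subset U by apply/fintype.subsetP => u; rewrite inE => /andP[].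
have MU : M \subset U.
  by apply/fintype.subsetP => u; rewrite !inE => /andP[/andP[]].
have NM : (#|U| <= 1 + (#|N| + #|M|))%N.
  rewrite (cardsD1 v) vU leq_add2l.
  apply: leq_trans (leq_card_setU N M); apply: subset_leq_card.
  apply/fintype.subsetP => u; rewrite !inE => /andP[-> ->] /=.
  by case: (edge G v u).
(* With [x = 2 ^ (a + b.+1)], at least [2x - 1] vertices remain besides [v], so one class has at
   least [x]. *)
have [NL|ML] : (2 ^ (a + b.+1) <= #|N|)%N \/ (2 ^ (a.+1 + b) <= #|M|)%N.
  apply/orP; rewrite addSnnS; move: Uab NM; rewrite addSn expnS.
  have : (0 < 2 ^ (a + b.+1))%N by rewrite expn_gt0.
  move: (2 ^ _)%N => x; lia.
- have [|S [SN hS]] := IHj a b.+1 _ N (fintype.subset_trans NU UG) NL; first by lia.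
  have SU := fintype.subset_trans SN NU.
  have [/andP[cS aS]|] := orP hS; last by exists S; rewrite SU b0 orbT.
  have vS u : u \in S -> edge G v u.
    by move/(fintype.subsetP SN); rewrite inE => /andP[].
  exists (v |: S)%SET; split; first by rewrite finset.subUset finset.sub1set vU.
  have -> : clique G (v |: S)%SET.
    have /andP[SG /forall_inP Sc] := cS.
    rewrite /clique finset.subUset finset.sub1set vG SG /=.
    apply/forall_inP => x /setU1P[->|xS]; apply/forall_inP => z /setU1P[->|zS].
    + by rewrite eqxx.
    + by rewrite vS // implybT.
    + by rewrite edge_sym vS // implybT.
    + by have /forall_inP := Sc _ xS; apply.
  rewrite finset.cardsU1 (_ : v \notin S) ?ltnS ?aS //.
  by apply/negP => /vS; rewrite edge_irr.
- have [|S [SM hS]] := IHj a.+1 b _ M (fintype.subset_trans MU UG) ML; first by lia.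
  have SU := fintype.subset_trans SM MU.
  have [|/andP[iS bS]] := orP hS; first by exists S; rewrite SU a0.
  have vS u : u \in S -> (u != v) && ~~ edge G v u.
    by move/(fintype.subsetP SM); rewrite !inE => /andP[/andP[-> _] ->].
  exists (v |: S)%SET; split; first by rewrite finset.subUset finset.sub1set vU.
  have -> : independent G (v |: S)%SET.
    have /andP[SG /forall_inP Si] := iS.
    rewrite /independent finset.subUset finset.sub1set vG SG /=.
    apply/forall_inP => x /setU1P[->|xS]; apply/forall_inP => z /setU1P[->|zS].
    + by rewrite edge_irr.
    + by have /andP[] := vS z zS.
    + by rewrite edge_sym; have /andP[] := vS x xS.
    + by have /forall_inP := Si _ xS; apply.
  rewrite finset.cardsU1 (_ : v \notin S) ?ltnS ?bS ?orbT //.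
  by apply/negP => /vS; rewrite eqxx.
Qed.

(** While at least [4 ^ k] vertices remain, Ramsey's theorem removes a homogeneous set of size at
    least [k]; the rest are covered by singletons. *)
Lemma homogeneous_cover (T : finType) (G : graph T) (k : nat) (U : {set T}) :
  (0 < k)%N -> U \subset verts G ->
  exists Q : {set {set T}},
    [/\ forall S, S \in Q -> clique G S || independent G S,
        forall v, v \in U -> exists2 S, S \in Q & v \in S &
        (k * #|Q| <= #|U| + k * 4 ^ k)%N].
Proof.
move=> k0; have [j jU] := ubnP #|U|; elim: j U jU => // j IHj U jU UG.
have [Uk|Uk] := ltnP #|U| (4 ^ k)%N.
  exists [set [set v] | v in U]%SET; split.
  - by move=> _ /imsetP[v vU ->]; exact: homogeneous_set1 (fintype.subsetP UG v vU).
  - by move=> v vU; exists [set v]%SET; rewrite ?inE //; apply/imsetP; exists v.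
  - apply: leq_trans (leq_addl _ _); rewrite leq_mul2l; apply/orP; right.
    exact: leq_trans (leq_imset_card _ _) (ltnW Uk).
have [|S [SU hS]] := @ramsey_homogeneous T G k k U UG.
  by rewrite addnn -mul2n expnM.
have kS : (k <= #|S|)%N by case/orP: hS => /andP[].
have {}hS : clique G S || independent G S.
  by case/orP: hS => /andP[->]; rewrite ?orbT.
have cU : #|U| = (#|S| + #|U :\: S|%SET)%N.
  by rewrite -(cardsID S U) (finset.setIidPr SU).
have [||Q [Qh QU Qk]] := IHj (U :\: S)%SET.
- by lia.
- exact: fintype.subset_trans (finset.subsetDl _ _) UG.
exists (S |: Q)%SET; split.
- by move=> D /setU1P[->|/Qh].
- move=> v vU; have [vS|vS] := boolP (v \in S).
    by exists S => //; rewrite !inE eqxx.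
  have [|D DQ vD] := QU v; first by rewrite inE vS.
  by exists D => //; rewrite !inE DQ orbT.
- apply: (@leq_trans (k * (1 + #|Q|))).
    by rewrite leq_mul2l finset.cardsU1 leq_add2r leq_b1 orbT.
  by rewrite mulnDr muln1 cU; lia.
Qed.

Lemma Z_f_le_card (R : realType) (T : finType) (G : graph T)
    (Q : {set {set T}}) :
  (forall v, v \in verts G -> exists S,
    [&& S \in Q, v \in S & clique G S || independent G S]) ->
  Z_f R G <= #|Q|%:R.
Proof.
move=> QG; pose w (S : {set T}) : R := (S \in Q)%:R.
apply: le_trans (min_cover_le (w := w) _) _; last first.
  rewrite /total_weight /w -sum1_card natr_sum [leRHS]big_mkcond /=.
  rewrite big_mkcond /=; apply: ler_sum => S _.
  by case: ifP; case: (S \in Q).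
split=> // v /QG[S /and3P[SQ vS hS]].
rewrite (bigD1 S) /= ?hS // /w SQ lerDl.
exact: sumr_ge0.
Qed.

(** For [m >= 16], [k] is about [log2 m / 4] and the leftover term [k * 4 ^ k] is at most [m], so at
    most [2 * m / k] sets suffice. *)
Lemma Z_f_upper_bound (R : realType) (m : nat) (H : graph 'I_m) : (2 <= m)%N ->
  Z_f R H <= 16 * (m%:R / log2 m%:R).
Proof.
move=> m2.
have ln2 : 0 < ln 2 :> R by rewrite ln_gt0 // ltr1n.
have logm : 0 < log2 (m%:R : R) by rewrite /log2 divr_gt0 // ln_gt0 // ltr1n.
have log_le j : (m <= 16 ^ j)%N -> log2 (m%:R : R) <= 4 * j%:R.
  move=> mj; rewrite /log2 ler_pdivrMr //.
  have -> : 4 * j%:R * ln 2 = ln (2 ^+ (4 * j)) :> R.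
    by rewrite lnXn // -[RHS]mulr_natl natrM.
  rewrite ler_ln ?posrE ?exprn_gt0 ?ltr0n ?(ltnW m2) //.
  by rewrite exprM -!natrX ler_nat.
pose k := maxn 1 (trunc_log 16 m).
have k0 : (0 < k)%N by rewrite leq_max.
have [Q [Qh QU Qk]] := homogeneous_cover k0 (fintype.subxx (verts H)).
apply: (@le_trans _ _ #|Q|%:R).
  apply: Z_f_le_card => v /QU[S SQ vS]; exists S.
  by rewrite SQ vS Qh.
rewrite mulrA ler_pdivlMr //.
have Vm : (#|verts H| <= m)%N by rewrite -[leqRHS]card_ord max_card.
suff [L [mL QL]] : exists L, (m <= 16 ^ L)%N /\ (#|Q| * (4 * L) <= 16 * m)%N.
  have : #|Q|%:R * log2 (m%:R : R) <= #|Q|%:R * (4 * L%:R).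
    by rewrite ler_wpM2l // log_le.
  by move/le_trans; apply; rewrite -!natrM ler_nat.
have [m16|m16] := ltnP m 16.
  have /eqP t0 : trunc_log 16 m == 0%N by rewrite trunc_log_eq0 -ltnS.
  have kE : k = 1%N by rewrite /k t0.
  by exists 1%N; rewrite ltnW //; move: Qk; rewrite kE mul1n expn1; lia.
have kE : k = trunc_log 16 m.
  by apply/maxn_idPr; rewrite trunc_log_gt0.
exists k.+1; split; first by rewrite ltnW // kE trunc_log_ltn.
have km : (k * 4 ^ k <= m)%N.
  have : (16 ^ k <= m)%N by rewrite kE trunc_logP // ltnW.
  apply: leq_trans; rewrite (expnMn 4 4) leq_mul2r.
  by rewrite (ltnW (ltn_expl _ _)) // orbT.
(* Here [k * #|Q| <= 2 * m] and [4 * k.+1 <= 8 * k]. *)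
nia.
Qed.

(** * Convergence of the error term and conclusion *)

Lemma log2_cvgy (R : realType) : log2 x @[x --> (+oo : set_system R)] --> +oo.
Proof.
have ln2 : 0 < ln 2 :> R by rewrite ln_gt0 // ltr1n.
apply/cvgryPge => A; near=> x.
rewrite /log2 ler_pdivlMr // -ler_expR lnK; first by near: x; exact: nbhs_pinfty_ge.
by rewrite posrE; near: x; exact: nbhs_pinfty_gt.
Unshelve. all: by end_near. Qed.

(** This error turns [(1 / 4 - eps x) * (x / log2 x)] into exactly [(x - 1) / (4 * log2 x + 26)]. *)
Lemma eps_cvg (R : realType) :
  (1 / 4 - (1 - x^-1) / (4 + 26 / log2 x) : R) @[x --> (+oo : set_system R)]
    --> (0 : R).
Proof.
have V0 (f : R -> R) : f x @[x --> +oo] --> +oo -> (f x)^-1 @[x --> +oo] --> 0.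
  move=> fy; apply/gtr0_cvgV0 => //.
  by have /cvgryPgt/(_ 0) := fy.
have -> : 0 = 1 / 4 - (1 - 0) / (4 + 26 * 0) :> R.
  by rewrite subr0 mulr0 addr0 subrr.
apply: cvgB; first exact: cvg_cst.
apply: cvgM; first by apply: cvgB; [exact: cvg_cst | apply: V0; exact: cvg_id].
apply: cvgV; first by rewrite mulr0 addr0.
apply: cvgD; first exact: cvg_cst.
by apply: cvgM; [exact: cvg_cst | apply: V0; exact: log2_cvgy].
Qed.

Theorem theorem5 (R : realType) :
  (exists eps : R -> R,
     eps m @[m --> +oo] --> (0 : R) /\
     forall (T : finType) (G : graph T) (m : R),
       chi_f R G = m ->
       exists H : graph T,
         subgraph H G /\ (1 / 4 - eps m) * (m / log2 m) <= Z_f R H) /\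
  (exists C : R,
     forall m : nat, (2 <= m)%N ->
       forall H : graph 'I_m,
         subgraph H (complete_graph m) ->
         Z_f R H <= C * (m%:R / log2 m%:R)).
Proof.
split; last by exists 16 => m m2 H _; exact: Z_f_upper_bound.
(* Up to 2 the value 1/4 reduces the claim to [0 <= Z_f], with [G] itself as witness; the limit is
   unaffected. *)
exists (fun x => if 2 < x then 1 / 4 - (1 - x^-1) / (4 + 26 / log2 x) else 1 / 4).
split.
  apply: cvg_trans (@eps_cvg R); apply: near_eq_cvg; near=> x.
  by rewrite ifT //; near: x; exact: nbhs_pinfty_gt.
move=> T G m <-; case: ifP => [m2|_]; last first.
  exists G; split; first by split.
  by rewrite subrr mul0r min_cover_ge0 //; exact: homogeneous_set1.
have [H [HG ZH]] := exists_subgraph_Z_f m2; exists H; split=> //.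
move: ZH; move: (chi_f R G) m2 => x x2; apply: le_trans.
have logm : 0 < log2 x by rewrite /log2 divr_gt0 // ln_gt0 ?ltr1n //; lra.
rewrite le_eqVlt; apply/orP; left; apply/eqP; field.
by rewrite !gt_eqF //; lra.
Unshelve. all: by end_near. Qed.
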